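(* Let $\mathcal{A}$ and $\mathcal{B}$ be abelian categories with enough projective and enough injective objects, $G:\mathcal{A}\to\mathcal{B}$ a left exact covariant functor, and $n\geqslant 1$ an integer. Then the following statements hold. (1) For every object $\begin{pmatrix}M_1\\ M_2\end{pmatrix}_{\varphi}$ of the comma category $(\mathcal{B}\downarrow G)$ and every object $Y$ of $\mathcal{B}$, $$\mathrm{Ext}_{(\mathcal{B}\downarrow G)}^{n}\left(\begin{pmatrix}M_1\\ M_2\end{pmatrix}_{\varphi},\begin{pmatrix}0\\ Y\end{pmatrix}_{0}\right)\cong\mathrm{Ext}_{\mathcal{B}}^{n}(M_2,Y).$$ (2) Let $X$ be an object of $\mathcal{A}$ and $\begin{pmatrix}Y_1\\ Y_2\end{pmatrix}_{\psi}$ an object of $(\mathcal{B}\downarrow G)$. If $(\mathrm{R}^jG)X=0$ for each $1\leqslant j\leqslant n$, then, for each $1\leqslant j\leqslant n$, $$\mathrm{Ext}_{(\mathcal{B}\downarrow G)}^{j}\left(\begin{pmatrix}Y_1\\ Y_2\end{pmatrix}_{\psi},\begin{pmatrix}X\\ G(X)\end{pmatrix}_{1}\right)\cong\mathrm{Ext}_{\mathcal{A}}^{j}(Y_1,X).$$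
   Context: Objects of the comma category $(\mathcal{B}\downarrow G)$ are triples $\begin{pmatrix}A\\ B\end{pmatrix}_{\phi}$ with $A\in\mathcal{A}$, $B\in\mathcal{B}$ and $\phi:B\to G(A)$ a morphism in $\mathcal{B}$; morphisms from $\begin{pmatrix}A\\ B\end{pmatrix}_{\phi}$ to $\begin{pmatrix}A'\\ B'\end{pmatrix}_{\phi'}$ are pairs $(a:A\to A',\,b:B\to B')$ with $\phi' b=G(a)\phi$. This category is abelian, and a short sequence in it is exact if and only if it is exact in both components. $\begin{pmatrix}0\\ Y\end{pmatrix}_{0}$ denotes the object with first component zero and zero structure map, and $\begin{pmatrix}X\\ G(X)\end{pmatrix}_{1}$ denotes the object whose structure map is the identity of $G(X)$. $\mathrm{R}^jG$ is the $j$-th right derived functor of $G$, computed by applying $G$ to a deleted injective resolution. *)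

(* Defs.v *)
From HB Require Import structures.
From mathcomp Require Import all_boot all_algebra boolp.

Set Implicit Arguments.
Unset Strict Implicit.
Unset Printing Implicit Defensive.

Import GRing.Theory.
Local Open Scope ring_scope.

(** * Preadditive and abelian categories *)

Structure preadd := Preadd {
  ob :> Type;
  Mor : ob -> ob -> zmodType;
  idm : forall X : ob, Mor X X;
  comp : forall X Y Z : ob, Mor Y Z -> Mor X Y -> Mor X Z;
  compA : forall (W X Y Z : ob) (h : Mor Y Z) (g : Mor X Y) (f : Mor W X),
    comp h (comp g f) = comp (comp h g) f;
  comp1m : forall (X Y : ob) (f : Mor X Y), comp (idm Y) f = f;
  compm1 : forall (X Y : ob) (f : Mor X Y), comp f (idm X) = f;
  compDl : forall (X Y Z : ob) (g h : Mor Y Z) (f : Mor X Y),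
    comp (g + h) f = comp g f + comp h f;
  compDr : forall (X Y Z : ob) (h : Mor Y Z) (f g : Mor X Y),
    comp h (f + g) = comp h f + comp h g }.

Arguments Mor {p} X Y.
Arguments idm {p} X.
Arguments comp {p X Y Z} g f.

Notation "g \oc f" := (comp g f)
  (at level 40, left associativity, format "g  \oc  f").

Section PreaddTheory.
Variable C : preadd.
Implicit Types X Y Z : C.

Definition postcomp (M X Y : C) (g : Mor X Y) (f : Mor M X) : Mor M Y :=
  g \oc f.

Lemma postcomp_is_zmod_morphism (M X Y : C) (g : Mor X Y) :
  zmod_morphism (@postcomp M X Y g).
Proof.
move=> f f'; apply: (addIr (g \oc f')).
by rewrite /postcomp -compDr addrNK addrNK.
Qed.

HB.instance Definition _ (M X Y : C) (g : Mor X Y) :=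
  GRing.isZmodMorphism.Build (Mor M X) (Mor M Y) (@postcomp M X Y g)
    (@postcomp_is_zmod_morphism M X Y g).

Lemma compm0 X Y Z (g : Mor Y Z) : g \oc (0 : Mor X Y) = 0.
Proof. by apply: (addrI (g \oc 0)); rewrite -compDr !addr0. Qed.

Lemma comp0m X Y Z (f : Mor X Y) : (0 : Mor Y Z) \oc f = 0.
Proof. by apply: (addrI (0 \oc f)); rewrite -compDl !addr0. Qed.

Lemma compmB X Y Z (h : Mor Y Z) (f g : Mor X Y) :
  h \oc (f - g) = h \oc f - h \oc g.
Proof. by apply: (addIr (h \oc g)); rewrite -compDr !addrNK. Qed.

Lemma compBm X Y Z (g h : Mor Y Z) (f : Mor X Y) :
  (g - h) \oc f = g \oc f - h \oc f.
Proof. by apply: (addIr (h \oc f)); rewrite -compDl !addrNK. Qed.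

Definition monomorphism X Y (f : Mor X Y) : Prop :=
  forall (T : C) (u v : Mor T X), f \oc u = f \oc v -> u = v.

Definition epimorphism X Y (f : Mor X Y) : Prop :=
  forall (T : C) (u v : Mor Y T), u \oc f = v \oc f -> u = v.

Definition is_kernel X Y (f : Mor X Y) (K : C) (k : Mor K X) : Prop :=
  f \oc k = 0 /\
  forall (T : C) (t : Mor T X), f \oc t = 0 ->
    exists! u : Mor T K, k \oc u = t.

Definition is_cokernel X Y (f : Mor X Y) (K : C) (c : Mor Y K) : Prop :=
  c \oc f = 0 /\
  forall (T : C) (t : Mor Y T), t \oc f = 0 ->
    exists! u : Mor K T, u \oc c = t.

(* X is initial and terminal; the zero morphisms witness existence *)
Definition is_zero X : Prop :=
  (forall (T : C) (f : Mor X T), f = 0) /\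
  (forall (T : C) (f : Mor T X), f = 0).

Record kernel X Y (f : Mor X Y) := Kernel {
  kobj : C;
  kmap : Mor kobj X;
  kernelP : is_kernel f kmap }.

Record cokernel X Y (f : Mor X Y) := Cokernel {
  cobj : C;
  cmap : Mor Y cobj;
  cokernelP : is_cokernel f cmap }.

Record biproduct X Y := Biproduct {
  bobj : C;
  in1 : Mor X bobj;
  in2 : Mor Y bobj;
  pr1 : Mor bobj X;
  pr2 : Mor bobj Y;
  pr1_in1 : pr1 \oc in1 = idm X;
  pr2_in2 : pr2 \oc in2 = idm Y;
  pr1_in2 : pr1 \oc in2 = 0;
  pr2_in1 : pr2 \oc in1 = 0;
  biprod_id : in1 \oc pr1 + in2 \oc pr2 = idm bobj }.

Definition injective_ob (I : C) : Prop :=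
  forall X Y (m : Mor X Y), monomorphism m ->
    forall f : Mor X I, exists g : Mor Y I, g \oc m = f.

Definition projective_ob (P : C) : Prop :=
  forall X Y (e : Mor X Y), epimorphism e ->
    forall f : Mor P Y, exists g : Mor P X, e \oc g = f.

Definition enough_injectives : Prop :=
  forall X, exists (I : C) (m : Mor X I), injective_ob I /\ monomorphism m.

Definition enough_projectives : Prop :=
  forall X, exists (P : C) (e : Mor P X), projective_ob P /\ epimorphism e.

End PreaddTheory.

Structure abcat := Abcat {
  apre :> preadd;
  zero_ob : apre;
  zero_obP : is_zero zero_ob;
  biprod : forall X Y : apre, biproduct X Y;
  ker : forall (X Y : apre) (f : Mor X Y), kernel f;
  coker : forall (X Y : apre) (f : Mor X Y), cokernel f;
  monic_normal : forall (X Y : apre) (f : Mor X Y), monomorphism f ->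
    exists (Z : apre) (g : Mor Y Z), is_kernel g f;
  epic_normal : forall (X Y : apre) (f : Mor X Y), epimorphism f ->
    exists (Z : apre) (g : Mor Z X), is_cokernel g f }.

Arguments zero_ob {a}.
Arguments zero_obP {a}.
Arguments biprod {a} X Y.
Arguments ker {a X Y} f.
Arguments coker {a X Y} f.

Section AbelianTheory.
Variable C : abcat.
Implicit Types X Y Z : C.

(* the image of f is the kernel of its cokernel *)
Definition im X Y (f : Mor X Y) : kernel (cmap (coker f)) :=
  ker (cmap (coker f)).

(* X --f--> Y --g--> Z is exact at Y: the image of f is a kernel of g *)
Definition exact X Y Z (f : Mor X Y) (g : Mor Y Z) : Prop :=
  is_kernel g (kmap (im f)).

Lemma kernel_monic X Y (f : Mor X Y) (K : C) (k : Mor K X) :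
  is_kernel f k -> monomorphism k.
Proof.
move=> [fk0 kP] T u v kuv.
have fku : f \oc (k \oc u) = 0 by rewrite compA fk0 comp0m.
have [w [_ wP]] := kP T _ fku.
by rewrite -(wP u erefl) -(wP v (esym kuv)).
Qed.

Lemma cokernel_epic X Y (f : Mor X Y) (K : C) (c : Mor Y K) :
  is_cokernel f c -> epimorphism c.
Proof.
move=> [cf0 cP] T u v cuv.
have ucf : (u \oc c) \oc f = 0 by rewrite -compA cf0 compm0.
have [w [_ wP]] := cP T _ ucf.
by rewrite -(wP u erefl) -(wP v (esym cuv)).
Qed.

Lemma monic_is_kernel X Y (f : Mor X Y) (K : C) (k : Mor K X) :
  monomorphism k -> f \oc k = 0 ->
  (forall T (t : Mor T X), f \oc t = 0 -> exists u : Mor T K, k \oc u = t) ->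
  is_kernel f k.
Proof.
move=> km fk0 kP; split=> // T t /kP [u ku]; exists u; split=> // v kv.
by apply: km; rewrite ku kv.
Qed.

Lemma epic_is_cokernel X Y (f : Mor X Y) (K : C) (c : Mor Y K) :
  epimorphism c -> c \oc f = 0 ->
  (forall T (t : Mor Y T), t \oc f = 0 -> exists u : Mor K T, u \oc c = t) ->
  is_cokernel f c.
Proof.
move=> ce cf0 cP; split=> // T t /cP [u cu]; exists u; split=> // v cv.
by apply: ce; rewrite cu cv.
Qed.

Lemma ker_lift_ex X Y (f : Mor X Y) (K : C) (k : Mor K X) :
  is_kernel f k -> forall T (t : Mor T X), f \oc t = 0 ->
  exists u : Mor T K, k \oc u = t.
Proof. by move=> [_ kP] T t /kP [u [ku _]]; exists u. Qed.

Lemma coker_lift_ex X Y (f : Mor X Y) (K : C) (c : Mor Y K) :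
  is_cokernel f c -> forall T (t : Mor Y T), t \oc f = 0 ->
  exists u : Mor K T, u \oc c = t.
Proof. by move=> [_ cP] T t /cP [u [cu _]]; exists u. Qed.

Lemma monic_of_ker0 X Y (f : Mor X Y) : kmap (ker f) = 0 -> monomorphism f.
Proof.
move=> k0 T u v fuv.
have f0 : f \oc (u - v) = 0 by rewrite compmB fuv subrr.
have [w kw] := ker_lift_ex (kernelP (ker f)) f0.
by apply/eqP; rewrite -subr_eq0 -kw k0 comp0m.
Qed.

Lemma epic_of_coker0 X Y (f : Mor X Y) : cmap (coker f) = 0 -> epimorphism f.
Proof.
move=> k0 T u v fuv.
have f0 : (u - v) \oc f = 0 by rewrite compBm fuv subrr.
have [w kw] := coker_lift_ex (cokernelP (coker f)) f0.
by apply/eqP; rewrite -subr_eq0 -kw k0 compm0.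
Qed.

Lemma monic_ker_coker X Y (f : Mor X Y) :
  monomorphism f -> is_kernel (cmap (coker f)) f.
Proof.
move=> fm; have [Z [g gf]] := monic_normal fm.
have [cf0 _] := cokernelP (coker f).
apply: monic_is_kernel => // T t ct0; apply: (ker_lift_ex gf).
have [h <-] := coker_lift_ex (cokernelP (coker f)) (proj1 gf).
by rewrite -compA ct0 compm0.
Qed.

Lemma epic_coker_ker X Y (f : Mor X Y) :
  epimorphism f -> is_cokernel (kmap (ker f)) f.
Proof.
move=> fe; have [Z [g gf]] := epic_normal fe.
have [fk0 _] := kernelP (ker f).
apply: epic_is_cokernel => // T t tk0; apply: (coker_lift_ex gf).
have [h <-] := ker_lift_ex (kernelP (ker f)) (proj1 gf).
by rewrite compA tk0 comp0m.
Qed.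

Lemma is_kernel_exact X Y Z (f : Mor X Y) (g : Mor Y Z) :
  is_kernel g f -> exact f g.
Proof.
move=> gf; have fm := kernel_monic gf.
have cf0 := proj1 (cokernelP (coker f)).
have [h gE] := coker_lift_ex (cokernelP (coker f)) (proj1 gf).
apply: monic_is_kernel.
- exact: kernel_monic (kernelP (im f)).
- by rewrite -gE -compA (proj1 (kernelP (im f))) compm0.
- move=> T t /(ker_lift_ex gf) [u <-].
  by apply: (ker_lift_ex (kernelP (im f))); rewrite compA cf0 comp0m.
Qed.

Lemma monic_exact_is_kernel X Y Z (f : Mor X Y) (g : Mor Y Z) :
  monomorphism f -> exact f g -> is_kernel g f.
Proof.
move=> fm fg; have kf := monic_ker_coker fm.
apply: monic_is_kernel => //.
- have [u <-] := ker_lift_ex (kernelP (im f)) (proj1 kf).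
  by rewrite compA (proj1 fg) comp0m.
- move=> T t /(ker_lift_ex fg) [u <-]; apply: (ker_lift_ex kf).
  by rewrite compA (proj1 (kernelP (im f))) comp0m.
Qed.

End AbelianTheory.

(** * Injective resolutions *)

Record injective_resolution (C : abcat) (X : C) := InjectiveResolution {
  res_ob : nat -> C;
  res_d : forall n, Mor (res_ob n) (res_ob n.+1);
  res_aug : Mor X (res_ob 0);
  res_inj : forall n, injective_ob (res_ob n);
  res_aug_monic : monomorphism res_aug;
  res_exact0 : exact res_aug (res_d 0);
  res_exactS : forall n, exact (res_d n) (res_d n.+1) }.

Section ResolutionExists.
Variables (C : abcat) (hC : enough_injectives C).

Record arrow := Arrow { adom : C; acod : C; amap : Mor adom acod }.

Let hull (X : C) :
  {I : C & {m : Mor X I | injective_ob I /\ monomorphism m}}.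
Proof. by have /cid [I /cid mP] := hC X; exists I. Qed.

Let next (f : arrow) : arrow :=
  Arrow (sval (projT2 (hull (cobj (coker (amap f))))) \oc
         cmap (coker (amap f))).

Let start (X : C) : arrow := Arrow (sval (projT2 (hull X))).

Let exact_next (f : arrow) : exact (amap f) (amap (next f)).
Proof.
have [_ mm] := svalP (projT2 (hull (cobj (coker (amap f))))).
have kP := kernelP (im (amap f)).
apply: monic_is_kernel; first exact: kernel_monic kP.
  by rewrite /= -compA (proj1 kP) compm0.
move=> T t /= mt0; apply: (ker_lift_ex kP); apply: mm.
by rewrite compA mt0 compm0.
Qed.

Lemma injective_resolution_exists (X : C) :
  exists r : injective_resolution X, True.
Proof.
pose s n := iter n next (start X).
have inj n : injective_ob (acod (s n)).
  case: n => [|n]; first by have [] := svalP (projT2 (hull X)).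
  by have [] := svalP (projT2 (hull (cobj (coker (amap (s n)))))).
have mono : monomorphism (amap (start X)) by have [] := svalP (projT2 (hull X)).
unshelve eexists; last by [].
exact: (@InjectiveResolution C X (fun n => acod (s n))
  (fun n => amap (s n.+1)) (amap (s 0)) inj mono
  (exact_next (s 0)) (fun n => exact_next (s n.+1))).
Qed.

Definition inj_res (X : C) : injective_resolution X :=
  sval (cid (injective_resolution_exists X)).

End ResolutionExists.

(** * Ext groups *)

(* Homology at V of U --f--> V --g--> W in abelian groups: ker g / im f *)
Section GroupHomology.
Variables (U V W : zmodType) (f : {additive U -> V}) (g : {additive V -> W}).

Definition cycle_pred : {pred V} := [pred x | g x == 0].

Fact cycle_zmod_closed : zmod_closed cycle_pred.
Proof.
split=> [|x y]; rewrite !inE ?raddf0 // raddfB.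
by move=> /eqP -> /eqP ->; rewrite subrr.
Qed.

HB.instance Definition _ :=
  GRing.isZmodClosed.Build V cycle_pred cycle_zmod_closed.

Record cycles := Cycle { cycle_val : V; _ : cycle_val \in cycle_pred }.

HB.instance Definition _ := [isSub for cycle_val].
HB.instance Definition _ := [Choice of cycles by <:].
HB.instance Definition _ := [SubChoice_isSubZmodule of cycles by <:].

Definition boundary_pred : {pred cycles} :=
  [pred z | `[< exists u, f u = val z >]].

Fact boundary_zmod_closed : zmod_closed boundary_pred.
Proof.
split=> [|x y]; first by apply/asboolP; exists 0; rewrite !raddf0.
move=> /asboolP [u fu] /asboolP [v fv]; apply/asboolP; exists (u - v).
by rewrite !raddfB fu fv.
Qed.

HB.instance Definition _ :=
  GRing.isZmodClosed.Build cycles boundary_pred boundary_zmod_closed.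

Definition group_homology : zmodType := Quotient.quot boundary_pred.

End GroupHomology.

(* H^n(Hom(M, I)) for the deleted injective resolution I *)
Definition hom_cohomology (C : abcat) (M N : C) (I : injective_resolution N)
    (n : nat) : zmodType :=
  match n with
  | 0 => group_homology (\0 : {additive Mor M (res_ob I 0) -> _})
           (@postcomp C M _ _ (res_d I 0))
  | m.+1 => group_homology (@postcomp C M _ _ (res_d I m))
              (@postcomp C M _ _ (res_d I m.+1))
  end.

(* The n-th right derived functor of Hom(M, -), so that only enough injectives
   are needed: the comma category below need not have enough projectives.
   The chosen resolution inj_res comes from classical choice. *)
Definition Ext (C : abcat) (hC : enough_injectives C) (n : nat) (M N : C) :
    zmodType :=
  hom_cohomology M (inj_res hC N) n.

Definition group_iso (U V : zmodType) : Prop :=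
  exists f : {additive U -> V}, bijective f.

(** * Left exact functors and right derived functors *)

(* Functors are additive, as is usual between abelian categories. *)
Structure functor (A B : preadd) := Functor {
  fob :> A -> B;
  fmap : forall X Y : A, Mor X Y -> Mor (fob X) (fob Y);
  fmap_id : forall X : A, fmap (idm X) = idm (fob X);
  fmap_comp : forall (X Y Z : A) (g : Mor Y Z) (f : Mor X Y),
    fmap (g \oc f) = fmap g \oc fmap f;
  fmapD : forall (X Y : A) (f g : Mor X Y), fmap (f + g) = fmap f + fmap g }.

Arguments fmap {A B} f0 {X Y} f.

Lemma fmap0 (A B : preadd) (G : functor A B) (X Y : A) :
  fmap G (0 : Mor X Y) = 0.
Proof. by apply: (addrI (fmap G 0)); rewrite -fmapD !addr0. Qed.

Lemma fmapB (A B : preadd) (G : functor A B) (X Y : A) (f g : Mor X Y) :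
  fmap G (f - g) = fmap G f - fmap G g.
Proof. by apply: (addIr (fmap G g)); rewrite -fmapD !addrNK. Qed.

Definition left_exact (A B : abcat) (G : functor A B) : Prop :=
  forall (X Y Z : A) (f : Mor X Y) (g : Mor Y Z),
    monomorphism f -> exact f g ->
    monomorphism (fmap G f) /\ exact (fmap G f) (fmap G g).

Section ObjectHomology.
Variables (C : abcat) (X Y Z : C) (f : Mor X Y) (g : Mor Y Z).
Hypothesis gf0 : g \oc f = 0.

Definition ker_lift : Mor X (kobj (ker g)) :=
  sval (cid (ker_lift_ex (kernelP (ker g)) gf0)).

(* homology at Y: the cokernel of X -> ker g *)
Definition homology : C := cobj (coker ker_lift).

End ObjectHomology.

Lemma res_dd (C : abcat) (X : C) (I : injective_resolution X) (n : nat) :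
  res_d I n.+1 \oc res_d I n = 0.
Proof.
have [u <-] := ker_lift_ex (kernelP (im (res_d I n)))
  (proj1 (cokernelP (coker (res_d I n)))).
by rewrite compA (proj1 (res_exactS I n)) comp0m.
Qed.

Section RightDerived.
Variables (A B : abcat) (G : functor A B).

Lemma fmap_res_dd (X : A) (I : injective_resolution X) (n : nat) :
  fmap G (res_d I n.+1) \oc fmap G (res_d I n) = 0.
Proof. by rewrite -fmap_comp res_dd fmap0. Qed.

(* H^n(G(I)) for the deleted injective resolution I *)
Definition functor_cohomology (X : A) (I : injective_resolution X)
    (n : nat) : B :=
  match n with
  | 0 => homology (compm0 (zero_ob : B) (fmap G (res_d I 0)))
  | m.+1 => homology (fmap_res_dd I m)
  end.

Definition right_derived (hA : enough_injectives A) (n : nat) (X : A) : B :=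
  functor_cohomology (inj_res hA X) n.

End RightDerived.

(** * The comma category of B over G *)

Section CommaPreadd.
Variables (A B : preadd) (G : functor A B).

Record comma_ob := CommaOb {
  co1 : A;
  co2 : B;
  co_map : Mor co2 (G co1) }.

Section CommaMor.
Variables M N : comma_ob.

Definition comma_pred :
    {pred (Mor (co1 M) (co1 N) * Mor (co2 M) (co2 N))%type} :=
  [pred p | co_map N \oc p.2 == fmap G p.1 \oc co_map M].

Fact comma_zmod_closed : zmod_closed comma_pred.
Proof.
split=> [|p q]; first by rewrite inE /= fmap0 compm0 comp0m.
rewrite !inE /= => /eqP ep /eqP eq.
by rewrite compmB ep eq fmapB compBm.
Qed.

HB.instance Definition _ :=
  GRing.isZmodClosed.Build _ comma_pred comma_zmod_closed.

Record comma_hom := CommaHom {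
  comma_val : (Mor (co1 M) (co1 N) * Mor (co2 M) (co2 N))%type;
  _ : comma_val \in comma_pred }.

HB.instance Definition _ := [isSub for comma_val].
HB.instance Definition _ := [Choice of comma_hom by <:].
HB.instance Definition _ := [SubChoice_isSubZmodule of comma_hom by <:].

Definition cm1 (f : comma_hom) : Mor (co1 M) (co1 N) := (val f).1.
Definition cm2 (f : comma_hom) : Mor (co2 M) (co2 N) := (val f).2.

Lemma comma_sq (f : comma_hom) :
  co_map N \oc cm2 f = fmap G (cm1 f) \oc co_map M.
Proof. exact/eqP/(valP f). Qed.

Definition mk_comma (a : Mor (co1 M) (co1 N)) (b : Mor (co2 M) (co2 N))
    (ab : co_map N \oc b = fmap G a \oc co_map M) : comma_hom :=
  @CommaHom (a, b) (introT eqP ab).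

Lemma comma_hom_eq (f g : comma_hom) :
  cm1 f = cm1 g -> cm2 f = cm2 g -> f = g.
Proof.
move=> e1 e2; apply: val_inj; move: e1 e2; rewrite /cm1 /cm2.
by case: (val f) (val g) => [? ?] [? ?] /= -> ->.
Qed.

End CommaMor.

Definition comma_id (M : comma_ob) : comma_hom M M.
Proof.
apply: (@mk_comma M M (idm _) (idm _)).
by rewrite fmap_id comp1m compm1.
Defined.

Definition comma_comp (M N P : comma_ob) (g : comma_hom N P)
  (f : comma_hom M N) : comma_hom M P.
Proof.
apply: (@mk_comma M P (cm1 g \oc cm1 f) (cm2 g \oc cm2 f)).
by rewrite compA comma_sq -compA comma_sq compA fmap_comp.
Defined.

Definition comma_preadd : preadd.
Proof.
apply: (@Preadd comma_ob (fun M N => comma_hom M N) comma_id comma_comp).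
- by move=> *; apply: comma_hom_eq; exact: compA.
- by move=> *; apply: comma_hom_eq; exact: comp1m.
- by move=> *; apply: comma_hom_eq; exact: compm1.
- by move=> *; apply: comma_hom_eq; exact: compDl.
- by move=> *; apply: comma_hom_eq; exact: compDr.
Defined.

End CommaPreadd.

Section CommaAbelian.
Variables (A B : abcat) (G : functor A B) (hG : left_exact G).

Local Notation D := (comma_preadd G).

Lemma fmap_monic (X Y : A) (f : Mor X Y) :
  monomorphism f -> monomorphism (fmap G f).
Proof.
move=> fm; have := is_kernel_exact (monic_ker_coker fm).
by move=> /(hG fm) [].
Qed.

Lemma fmap_kernel (X Y K : A) (f : Mor X Y) (k : Mor K X) :
  is_kernel f k -> is_kernel (fmap G f) (fmap G k).
Proof.
move=> fk; have [] := hG (kernel_monic fk) (is_kernel_exact fk).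
exact: monic_exact_is_kernel.
Qed.

Definition comma_zero : D := @CommaOb A B G zero_ob zero_ob 0.

Fact comma_zeroP : is_zero comma_zero.
Proof.
have [a0 a1] := @zero_obP A; have [b0 b1] := @zero_obP B.
by split=> T f; apply: comma_hom_eq;
  rewrite ?a0 ?b0 ?a1 ?b1 //; exact/esym.
Qed.

Section Biproduct.
Variables M N : D.
Let P1 := biprod (co1 M) (co1 N).
Let P2 := biprod (co2 M) (co2 N).

Let bmap : Mor (bobj P2) (G (bobj P1)) :=
  fmap G (in1 P1) \oc co_map M \oc pr1 P2 +
  fmap G (in2 P1) \oc co_map N \oc pr2 P2.

Let bo : D := CommaOb bmap.

Let bin1 : Mor M bo.
Proof.
apply: (@mk_comma A B G M bo (in1 P1) (in1 P2)).
rewrite /= /bmap compDl -!compA pr1_in1 pr2_in1.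
by rewrite !compm0 addr0 compm1.
Defined.

Let bin2 : Mor N bo.
Proof.
apply: (@mk_comma A B G N bo (in2 P1) (in2 P2)).
rewrite /= /bmap compDl -!compA pr1_in2 pr2_in2.
by rewrite !compm0 add0r compm1.
Defined.

Let bpr1 : Mor bo M.
Proof.
apply: (@mk_comma A B G bo M (pr1 P1) (pr1 P2)).
rewrite /= /bmap compDr !compA -!fmap_comp pr1_in1 pr1_in2.
by rewrite fmap0 fmap_id comp1m !comp0m addr0.
Defined.

Let bpr2 : Mor bo N.
Proof.
apply: (@mk_comma A B G bo N (pr2 P1) (pr2 P2)).
rewrite /= /bmap compDr !compA -!fmap_comp pr2_in1 pr2_in2.
by rewrite fmap0 fmap_id comp1m !comp0m add0r.
Defined.

Definition comma_biprod : biproduct M N.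
Proof.
apply: (@Biproduct D M N bo bin1 bin2 bpr1 bpr2).
- by apply: comma_hom_eq; exact: pr1_in1.
- by apply: comma_hom_eq; exact: pr2_in2.
- by apply: comma_hom_eq; exact: pr1_in2.
- by apply: comma_hom_eq; exact: pr2_in1.
- by apply: comma_hom_eq; exact: biprod_id.
Defined.

End Biproduct.

Lemma comma_is_kernel (K M N : D) (f : Mor M N) (k : Mor K M) :
  is_kernel (cm1 f) (cm1 k) -> is_kernel (cm2 f) (cm2 k) -> is_kernel f k.
Proof.
move=> k1 k2.
have m1 := kernel_monic k1; have m2 := kernel_monic k2.
split; first by apply: comma_hom_eq; [exact: (proj1 k1)|exact: (proj1 k2)].
move=> T t ft0.
have [u1 ku1] := ker_lift_ex k1 (congr1 (@cm1 _ _ _ _ _) ft0).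
have [u2 ku2] := ker_lift_ex k2 (congr1 (@cm2 _ _ _ _ _) ft0).
have sq : co_map K \oc u2 = fmap G u1 \oc co_map T.
  apply: (fmap_monic m1).
  by rewrite !compA -comma_sq -compA ku2 comma_sq -ku1 fmap_comp.
exists (mk_comma sq); split; first exact: comma_hom_eq.
move=> v kv; apply: comma_hom_eq.
  by apply: m1; rewrite ku1 -kv.
by apply: m2; rewrite ku2 -kv.
Qed.

Lemma comma_is_cokernel (K M N : D) (f : Mor M N) (c : Mor N K) :
  is_cokernel (cm1 f) (cm1 c) -> is_cokernel (cm2 f) (cm2 c) ->
  is_cokernel f c.
Proof.
move=> c1 c2.
have e1 := cokernel_epic c1; have e2 := cokernel_epic c2.
split; first by apply: comma_hom_eq; [exact: (proj1 c1)|exact: (proj1 c2)].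
move=> T t tf0.
have [u1 uc1] := coker_lift_ex c1 (congr1 (@cm1 _ _ _ _ _) tf0).
have [u2 uc2] := coker_lift_ex c2 (congr1 (@cm2 _ _ _ _ _) tf0).
have sq : co_map T \oc u2 = fmap G u1 \oc co_map K.
  apply: e2.
  by rewrite -!compA uc2 !comma_sq -uc1 fmap_comp compA.
exists (mk_comma sq); split; first exact: comma_hom_eq.
move=> v vc; apply: comma_hom_eq.
  by apply: e1; rewrite uc1 -vc.
by apply: e2; rewrite uc2 -vc.
Qed.

Section KernelCokernel.
Variables (M N : D) (f : Mor M N).
Let k1 := kernelP (ker (cm1 f)).
Let k2 := kernelP (ker (cm2 f)).
Let c1 := cokernelP (coker (cm1 f)).
Let c2 := cokernelP (coker (cm2 f)).

Let kob_ex : exists u : Mor (kobj (ker (cm2 f))) (G (kobj (ker (cm1 f)))),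
  fmap G (kmap (ker (cm1 f))) \oc u = co_map M \oc kmap (ker (cm2 f)).
Proof.
apply: (ker_lift_ex (fmap_kernel k1)).
by rewrite compA -comma_sq -compA (proj1 k2) compm0.
Qed.

Let cob_ex : exists u : Mor (cobj (coker (cm2 f))) (G (cobj (coker (cm1 f)))),
  u \oc cmap (coker (cm2 f)) = fmap G (cmap (coker (cm1 f))) \oc co_map N.
Proof.
apply: (coker_lift_ex c2).
by rewrite -compA comma_sq compA -fmap_comp (proj1 c1) fmap0 comp0m.
Qed.

Let kob : D := CommaOb (sval (cid kob_ex)).
Let cob : D := CommaOb (sval (cid cob_ex)).

Let kob_map : Mor kob M :=
  @mk_comma A B G kob M _ _ (esym (svalP (cid kob_ex))).
Let cob_map : Mor N cob :=
  @mk_comma A B G N cob _ _ (svalP (cid cob_ex)).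

Definition comma_ker : kernel f.
Proof. by apply: (@Kernel D M N f kob kob_map); exact: comma_is_kernel. Defined.

Definition comma_coker : cokernel f.
Proof.
by apply: (@Cokernel D M N f cob cob_map); exact: comma_is_cokernel.
Defined.

Lemma comma_monic :
  monomorphism f -> monomorphism (cm1 f) /\ monomorphism (cm2 f).
Proof.
move=> fm; have k0 : kob_map = 0.
  apply: fm; rewrite compm0.
  by apply: comma_hom_eq; [exact: (proj1 k1)|exact: (proj1 k2)].
split; apply: monic_of_ker0.
  exact: (congr1 (@cm1 _ _ _ _ _) k0).
exact: (congr1 (@cm2 _ _ _ _ _) k0).
Qed.

Lemma comma_epic :
  epimorphism f -> epimorphism (cm1 f) /\ epimorphism (cm2 f).
Proof.
move=> fe; have k0 : cob_map = 0.
  apply: fe; rewrite comp0m.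
  by apply: comma_hom_eq; [exact: (proj1 c1)|exact: (proj1 c2)].
split; apply: epic_of_coker0.
  exact: (congr1 (@cm1 _ _ _ _ _) k0).
exact: (congr1 (@cm2 _ _ _ _ _) k0).
Qed.

Fact comma_monic_normal :
  monomorphism f -> exists (Z : D) (g : Mor N Z), is_kernel g f.
Proof.
move=> /comma_monic [m1 m2]; exists cob, cob_map.
by apply: comma_is_kernel; exact: monic_ker_coker.
Qed.

Fact comma_epic_normal :
  epimorphism f -> exists (Z : D) (g : Mor Z M), is_cokernel g f.
Proof.
move=> /comma_epic [m1 m2]; exists kob, kob_map.
by apply: comma_is_cokernel; exact: epic_coker_ker.
Qed.

End KernelCokernel.

Definition comma : abcat :=
  @Abcat D comma_zero comma_zeroP comma_biprod comma_ker comma_coker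
    comma_monic_normal comma_epic_normal.

Definition triple (X : A) (Y : B) (phi : Mor Y (G X)) : comma :=
  CommaOb phi.

(* the object with components 0 and Y, and zero structure map *)
Definition comma_zero_left (Y : B) : comma :=
  triple (0 : Mor Y (G zero_ob)).

(* the object with components X and G X, and identity structure map *)
Definition comma_unit (X : A) : comma := triple (idm (G X)).

Lemma comma_zero_left_injective (J : B) :
  injective_ob J -> injective_ob (comma_zero_left J).
Proof.
move=> hJ M N m /comma_monic [_ m2] f.
have [s sm] := hJ _ _ _ m2 (cm2 f).
have sq : co_map (comma_zero_left J) \oc s =
    fmap G (0 : Mor (co1 N) zero_ob) \oc co_map N.
  by rewrite /= comp0m fmap0 comp0m.
exists (@mk_comma A B G N (comma_zero_left J) _ _ sq).
apply: comma_hom_eq => //.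
by rewrite (proj2 zero_obP _ (cm1 f)); exact: (proj2 zero_obP).
Qed.

Lemma comma_unit_injective (I : A) :
  injective_ob I -> injective_ob (comma_unit I).
Proof.
move=> hI M N m /comma_monic [m1 _] f.
have [s sm] := hI _ _ _ m1 (cm1 f).
have sq : co_map (comma_unit I) \oc (fmap G s \oc co_map N) =
    fmap G s \oc co_map N by rewrite /= comp1m.
exists (@mk_comma A B G N (comma_unit I) _ _ sq).
apply: comma_hom_eq => //.
have /= := comma_sq f; rewrite comp1m => ->.
change (fmap G s \oc co_map N \oc cm2 m = fmap G (cm1 f) \oc co_map M).
by rewrite -compA comma_sq compA -fmap_comp sm.
Qed.

Lemma biproduct_injective (C : preadd) (X Y : C) (P : biproduct X Y) :
  injective_ob X -> injective_ob Y -> injective_ob (bobj P).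
Proof.
move=> hX hY M N m mm f.
have [g1 e1] := hX _ _ _ mm (pr1 P \oc f).
have [g2 e2] := hY _ _ _ mm (pr2 P \oc f).
exists (in1 P \oc g1 + in2 P \oc g2).
by rewrite compDl -!compA e1 e2 !compA -compDl biprod_id comp1m.
Qed.

Lemma comma_enough_injectives (hA : enough_injectives A)
  (hB : enough_injectives B) : enough_injectives comma.
Proof.
move=> M.
have [I [m [hI mm]]] := hA (co1 M); have [J [l [hJ lm]]] := hB (co2 M).
have sq1 : co_map (comma_unit I) \oc (fmap G m \oc co_map M) =
    fmap G m \oc co_map M by rewrite /= comp1m.
have sq2 : co_map (comma_zero_left J) \oc l =
    fmap G (0 : Mor (co1 M) zero_ob) \oc co_map M.
  by rewrite /= comp0m fmap0 comp0m.
pose f : Mor M (comma_unit I) := mk_comma sq1.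
pose g : Mor M (comma_zero_left J) := mk_comma sq2.
pose P := @biprod comma (comma_unit I) (comma_zero_left J).
exists (bobj P), (in1 P \oc f + in2 P \oc g); split.
  apply: biproduct_injective; first exact: comma_unit_injective.
  exact: comma_zero_left_injective.
move=> T u v e; apply: comma_hom_eq.
  apply: mm; apply: (congr1 (@cm1 _ _ _ _ _) (_ : f \oc u = f \oc v)).
  move/(congr1 (fun h => pr1 P \oc h)): e.
  by rewrite !compA compDr !compA pr1_in1 pr1_in2 comp1m comp0m addr0.
apply: lm; apply: (congr1 (@cm2 _ _ _ _ _) (_ : g \oc u = g \oc v)).
move/(congr1 (fun h => pr2 P \oc h)): e.
by rewrite !compA compDr !compA pr2_in1 pr2_in2 comp1m comp0m add0r.
Qed.

End CommaAbelian.

Arguments triple {A B G} hG {X Y} phi.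
Arguments comma_zero_left {A B G} hG Y.
Arguments comma_unit {A B G} hG X.
Arguments comma_enough_injectives {A B G} hG hA hB.

(* Main.v *)
From HB Require Import structures.
From mathcomp Require Import all_boot all_algebra boolp.
Require Import Defs.

(** Both isomorphisms are one phenomenon.  The functors sending Y to the object
with components 0 and Y, and X to the object with components X and G X, are
right adjoint to the two exact projections of the comma category: a morphism
from (M1, M2) to (0, Y) is just a morphism from M2 to Y, and a morphism from
(Y1, Y2) to (X, G X) is determined by its first component, which is arbitrary.
Being right adjoint to functors that preserve monomorphisms, they preserve
injective objects.

Let R be such a right adjoint, and I an injective resolution of X.  The
adjunction identifies the complex Hom(L, I) with Hom(M, R I), where L is the
projection of M ([transpose_cohomology_iso]); so Ext(M, R X) agrees with
Ext(L, X) as soon as R I may be used to compute Ext(M, R X).  For the degrees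
up to n this holds when R I is exact up to degree n: the maps between two
resolutions that lift the identity, and the homotopies that make them mutually
inverse, are built one degree at a time, and what matters for degree j only
requires exactness up to degree j ([comparison_iso]).  Hence
[ext_universal_iso].

Exactness in the comma category is checked on components ([comma_exact]).  For
(0, Y) the first component is the zero complex and the second is I itself.  For
(X, G X) the second component is the complex G I: its homology in degrees
1, ..., n consists of the derived functors assumed to vanish, while left
exactness of G takes care of degree 0 ([unit_resolves]). *)

Set Implicit Arguments.
Unset Strict Implicit.
Unset Printing Implicit Defensive.

Import GRing.Theory.

(** * Isomorphisms of abelian groups and of their homology *)

Section GroupIso.
Local Open Scope ring_scope.
Local Open Scope quotient_scope.

Lemma inj_surj_group_iso (U V : zmodType) (f : {additive U -> V}) :
  injective f -> (forall v, exists u, f u = v) -> group_iso U V.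
Proof.
move=> f_inj f_surj; exists f.
pose g v := sval (cid (f_surj v)).
have gK : cancel g f by move=> v; exact: svalP (cid (f_surj v)).
by exists g => // u; apply: f_inj; rewrite gK.
Qed.

Lemma group_iso_sym (U V : zmodType) : group_iso U V -> group_iso V U.
Proof.
move=> [f [g fK gK]].
pose gM := GRing.isZmodMorphism.Build V U g (can2_zmod_morphism fK gK).
pose ga : {additive V -> U} := HB.pack g gM.
by exists ga, f.
Qed.

Lemma group_iso_trans (U V W : zmodType) :
  group_iso U V -> group_iso V W -> group_iso U W.
Proof. by move=> [f fB] [g gB]; exists (g \o f); exact: bij_comp. Qed.

(** A morphism of complexes inducing a bijection on homology, where only the
three groups around the homology are given: [phi] is a map of the middle groups
alone, and its compatibility with the differentials is reduced to what it does
to cycles and boundaries. *)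
Section HomologyIso.
Variables (U V W U' V' W' : zmodType).
Variables (f : {additive U -> V}) (g : {additive V -> W}).
Variables (f' : {additive U' -> V'}) (g' : {additive V' -> W'}).
Variable phi : {additive V -> V'}.

Hypothesis phi_cycle : forall v, g v = 0 -> g' (phi v) = 0.
Hypothesis phi_boundary : forall u, exists u', f' u' = phi (f u).

Let Z := cycles g.
Let H' := group_homology f' g'.

Let phi_cycle_in (z : Z) : phi (val z) \in cycle_pred g'.
Proof. by apply/eqP/phi_cycle/eqP; exact: valP z. Qed.

Let phiZ (z : Z) : cycles g' := Cycle (phi_cycle_in z).

Let piH z : group_homology f g := \pi_(group_homology f g) z.
Let piH' z : H' := \pi_H' z.

Let piH_eq x y : (exists u, f u = val x - val y) <-> piH x = piH y.
Proof.
split=> [fu|/eqP].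
  by apply/eqP; rewrite -Quotient.idealrBE; apply/asboolP.
by rewrite -Quotient.idealrBE => /asboolP.
Qed.

Let piH'_eq x y : (exists u, f' u = val x - val y) <-> piH' x = piH' y.
Proof.
split=> [fu|/eqP].
  by apply/eqP; rewrite -Quotient.idealrBE; apply/asboolP.
by rewrite -Quotient.idealrBE => /asboolP.
Qed.

Let phiH (x : group_homology f g) : H' := piH' (phiZ (repr x)).

Let phiH_pi z : phiH (piH z) = piH' (phiZ z).
Proof.
apply/piH'_eq; rewrite /= -raddfB.
have /piH_eq [u <-] : piH (repr (piH z)) = piH z by exact: reprK.
exact: phi_boundary.
Qed.

Let phiH_additive : zmod_morphism phiH.
Proof.
move=> x y; rewrite -[x]reprK -[y]reprK.
have -> : \pi_(group_homology f g) (repr x) - \pi_(group_homology f g) (repr y)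
  = piH (repr x - repr y) by rewrite /piH raddfB.
rewrite !phiH_pi.
have -> : phiZ (repr x - repr y) = phiZ (repr x) - phiZ (repr y).
  by apply: val_inj; rewrite /= raddfB.
by rewrite /piH' raddfB.
Qed.

Lemma group_homology_iso :
  (forall v, g v = 0 -> (exists u', f' u' = phi v) -> exists u, f u = v) ->
  (forall v', g' v' = 0 ->
     exists2 v, g v = 0 & exists u', f' u' = phi v - v') ->
  group_iso (group_homology f g) (group_homology f' g').
Proof.
move=> phi_inj phi_surj.
pose phiM := GRing.isZmodMorphism.Build _ _ phiH phiH_additive.
pose phiA : {additive group_homology f g -> H'} := HB.pack phiH phiM.
apply: (@inj_surj_group_iso _ _ phiA) => [x y|y].
  rewrite -[x]reprK -[y]reprK /= !phiH_pi => /piH'_eq [u'].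
  rewrite /= -raddfB => fu'; apply/piH_eq.
  apply: phi_inj; last by exists u'.
  have /eqP gx := valP (repr x); have /eqP gy := valP (repr y).
  by rewrite raddfB gx gy subrr.
have /eqP gy := valP (repr y); have [v gv [u' fu']] := phi_surj _ gy.
exists (piH (Cycle (introT eqP gv))); rewrite /= phiH_pi -[RHS]reprK.
by apply/piH'_eq; exists u'.
Qed.

End HomologyIso.
End GroupIso.

(** * Extending morphisms into injective objects *)

Section Extension.
Local Open Scope ring_scope.

Lemma exact_comp0 (C : abcat) (X Y Z : C) (f : Mor X Y) (g : Mor Y Z) :
  exact f g -> g \oc f = 0.
Proof.
move=> fg.
have [u <-] := ker_lift_ex (kernelP (im f)) (proj1 (cokernelP (coker f))).
by rewrite compA (proj1 fg) comp0m.
Qed.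

(** The first isomorphism theorem.  If q is the cokernel of the kernel of m, the
epimorphism from Y through q is a cokernel of its own kernel, and this kernel
dies in the cokernel of f because it dies under g.  So the cokernel of f factors
back through q, which makes q split monic, and the kernel of m vanishes. *)
Lemma exact_coker_monic (C : abcat) (X Y Z : C) (f : Mor X Y) (g : Mor Y Z)
    (m : Mor (cobj (coker f)) Z) :
  exact f g -> m \oc cmap (coker f) = g -> monomorphism m.
Proof.
move=> fg mc; set c := cmap (coker f) in mc *.
have c_epi : epimorphism c := cokernel_epic (cokernelP (coker f)).
set q := cmap (coker (kmap (ker m))).
have [qk0 _] := cokernelP (coker (kmap (ker m))).
have [m' m'q] := coker_lift_ex (cokernelP (coker (kmap (ker m))))
  (proj1 (kernelP (ker m))).
have qc_epi : epimorphism (q \oc c).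
  move=> T u v; rewrite !compA => /c_epi.
  exact: cokernel_epic (cokernelP (coker (kmap (ker m)))) _ _ _.
have ck0 : c \oc kmap (ker (q \oc c)) = 0.
  have gk0 : g \oc kmap (ker (q \oc c)) = 0.
    have -> : g = m' \oc (q \oc c) by rewrite compA m'q.
    by rewrite -compA (proj1 (kernelP (ker (q \oc c)))) compm0.
  have [u <-] := ker_lift_ex fg gk0.
  by rewrite compA (proj1 (kernelP (im f))) comp0m.
have [r rqc] := coker_lift_ex (epic_coker_ker qc_epi) ck0.
have rq : r \oc q = idm _ by apply: c_epi; rewrite -compA rqc comp1m.
by apply: monic_of_ker0; rewrite -[LHS]comp1m -rq -compA qk0 compm0.
Qed.

(** The contravariant functor Hom(-, I) is exact; both lifts and homotopies come
from this. *)
Lemma exact_extend (C : abcat) (X Y Z I : C) (f : Mor X Y) (g : Mor Y Z) :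
  exact f g -> injective_ob I ->
  forall t : Mor Y I, t \oc f = 0 -> exists s, s \oc g = t.
Proof.
move=> fg hI t tf0.
have [m mc] := coker_lift_ex (cokernelP (coker f)) (exact_comp0 fg).
have [t' t'c] := coker_lift_ex (cokernelP (coker f)) tf0.
have [s sm] := hI _ _ _ (exact_coker_monic fg mc) t'.
by exists s; rewrite -mc compA sm.
Qed.

(** Totalised by 0, so that lifts and homotopies can be defined by plain
recursion in all degrees, although they are meaningful only as far as the
complexes are exact. *)
Definition extend (C : preadd) (X Y I : C) (i : Mor X Y) (t : Mor X I) :
    Mor Y I :=
  if pselect (exists s, s \oc i = t) is left ex then sval (cid ex) else 0.

Lemma extendK (C : preadd) (X Y I : C) (i : Mor X Y) (t : Mor X I) :
  (exists s, s \oc i = t) -> extend i t \oc i = t.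
Proof.
by move=> ex; rewrite /extend; case: pselect => // ex'; exact: svalP (cid ex').
Qed.

End Extension.

(** * Comparison of partial injective resolutions *)

Section Comparison.
Local Open Scope ring_scope.

(** Resolutions are taken in augmented form: the term of index 0 is the resolved
object and the term of index k + 1 is the one of degree k. *)
Record cochain (C : preadd) := Cochain {
  cterm :> nat -> C;
  cdiff : forall k, Mor (cterm k) (cterm k.+1);
  cdiff2 : forall k, cdiff k.+1 \oc cdiff k = 0 }.

(** Exactness at the indices 1, ..., n, that is, in degrees 0, ..., n - 1. *)
Definition resolves_upto (C : abcat) (n : nat) (X : cochain C) : Prop :=
  [/\ monomorphism (cdiff X 0),
      forall k, (k < n)%N -> exact (cdiff X k) (cdiff X k.+1) &
      forall k, injective_ob (cterm X k.+1)].

Definition cochain_cohomology (C : preadd) (M : C) (X : cochain C) (k : nat) :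
    zmodType :=
  group_homology (@postcomp C M _ _ (cdiff X k))
    (@postcomp C M _ _ (cdiff X k.+1)).

Variable C : abcat.

Fixpoint lift_along (X Y : cochain C) (phi : Mor (X 0) (Y 0)) (k : nat) :
    Mor (X k) (Y k) :=
  if k is k'.+1 then extend (cdiff X k') (cdiff Y k' \oc lift_along phi k')
  else phi.

(** The composite of the lift at index k with the differential of [Y] kills the
preceding differential of [X], so exactness of [X] at index k extends it to
index k + 1. *)
Lemma lift_alongP n (X Y : cochain C) (phi : Mor (X 0) (Y 0)) :
  resolves_upto n X -> (forall k, injective_ob (Y k.+1)) ->
  forall k, (k <= n)%N ->
    lift_along phi k.+1 \oc cdiff X k = cdiff Y k \oc lift_along phi k.
Proof.
move=> [Xm Xe _] Yi; elim=> [|k IHk] kn; apply: extendK.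
  exact: Yi Xm _.
apply: exact_extend (Xe _ kn) (Yi _) _ _.
by rewrite -compA IHk ?(ltnW kn) // compA cdiff2 comp0m.
Qed.

Fixpoint homotopy (X Y : cochain C) (u : forall k, Mor (X k) (Y k)) (k : nat) :
    Mor (X k.+1) (Y k) :=
  if k is k'.+1 then
    extend (cdiff X k'.+1) (u k'.+1 - cdiff Y k' \oc homotopy u k')
  else 0.

(** A lift of the zero map is null-homotopic.  The difference between it and the
part supplied by the homotopy so far vanishes on the image of the preceding
differential, by the homotopy relation one step below, so it extends to the next
component of the homotopy. *)
Lemma homotopyP n (X Y : cochain C) (u : forall k, Mor (X k) (Y k)) :
  resolves_upto n X -> (forall k, injective_ob (Y k.+1)) -> u 0%N = 0 ->
  (forall k, (k <= n)%N -> u k.+1 \oc cdiff X k = cdiff Y k \oc u k) ->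
  forall k, (k < n)%N ->
    u k.+1 = cdiff Y k \oc homotopy u k + homotopy u k.+1 \oc cdiff X k.+1.
Proof.
move=> [Xm Xe _] Yi u0 ud k kn.
suff ex : exists s, s \oc cdiff X k.+1 = u k.+1 - cdiff Y k \oc homotopy u k.
  by rewrite [homotopy u k.+1]/= (extendK ex) addrC subrK.
apply: exact_extend (Xe _ kn) (Yi _) _ _.
elim: k kn => [|k IHk] kn.
  by rewrite /= compm0 subr0 ud // u0 compm0.
rewrite compBm ud ?(ltnW kn) // -compA -compmB.
rewrite [homotopy u k.+1]/= extendK.
  by rewrite opprB addrC subrK compA cdiff2 comp0m.
apply: exact_extend (Xe _ (ltnW kn)) (Yi _) _ _; exact: IHk (ltnW kn).
Qed.

(** The composite of the two lifts minus the identity lifts 0, so it is homotopic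
to 0, hence takes cycles to boundaries. *)
Lemma lift_along_homotopic n (X Y : cochain C) (M : C)
    (phi : Mor (X 0) (Y 0)) (psi : Mor (Y 0) (X 0)) :
  resolves_upto n X -> resolves_upto n Y -> psi \oc phi = idm _ ->
  forall k, (k < n)%N -> forall v : Mor M (X k.+1), cdiff X k.+1 \oc v = 0 ->
  exists w, cdiff X k \oc w
    = lift_along psi k.+1 \oc (lift_along phi k.+1 \oc v) - v.
Proof.
move=> Xr Yr psiphi k kn v dv0.
pose u k := lift_along psi k \oc lift_along phi k - idm (X k).
have [_ _ Xi] := Xr; have [_ _ Yi] := Yr.
have u0 : u 0%N = 0 by rewrite /u /= psiphi subrr.
have ud l : (l <= n)%N -> u l.+1 \oc cdiff X l = cdiff X l \oc u l.
  move=> ln; rewrite /u compBm compmB comp1m compm1.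
  by rewrite -compA (lift_alongP phi Xr Yi ln) compA (lift_alongP psi Yr Xi ln)
    -compA.
exists (homotopy u k \oc v).
transitivity (u k.+1 \oc v); last by rewrite compBm comp1m compA.
by rewrite (homotopyP Xr Xi u0 ud kn) compDl -!compA dv0 compm0 addr0.
Qed.

(** Cohomology of Hom(M, -) does not depend on the resolution, even if it is exact
only as far as the degree in question. *)
Lemma comparison_iso n (X Y : cochain C) (M : C)
    (phi : Mor (X 0) (Y 0)) (psi : Mor (Y 0) (X 0)) :
  resolves_upto n X -> resolves_upto n Y ->
  psi \oc phi = idm _ -> phi \oc psi = idm _ ->
  forall k, (k < n)%N ->
    group_iso (cochain_cohomology M X k) (cochain_cohomology M Y k).
Proof.
move=> Xr Yr psiphi phipsi k kn.
have := lift_along_homotopic Yr Xr phipsi kn (M := M).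
have := lift_along_homotopic Xr Yr psiphi kn (M := M).
have [_ _ Xi] := Xr; have [_ _ Yi] := Yr.
have := lift_alongP psi Yr Xi; have := lift_alongP phi Xr Yi.
move: (lift_along phi) (lift_along psi) => f g fd gd gf fg.
apply: (@group_homology_iso _ _ _ _ _ _ _ _ _ _ (@postcomp C M _ _ (f k.+1))).
- move=> v dv; rewrite /= /postcomp compA -fd // -compA.
  by rewrite [cdiff X _ \oc _]dv compm0.
- by move=> v; exists (f k \oc v); rewrite /= /postcomp !compA fd // ltnW.
- move=> v dv [v' fv]; have [w dw] := gf v dv.
  (* v = g (f v) - d w, and f v = d v'. *)
  exists (g k \oc v' - w).
  rewrite /= /postcomp compmB dw compA -gd ?(ltnW kn) // -compA.
  by rewrite [cdiff Y k \oc v']fv opprB addrC subrK.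
- move=> v' dv'; exists (g k.+1 \oc v'); last exact: fg.
  by rewrite /= /postcomp compA -gd // -compA [cdiff Y _ \oc _]dv' compm0.
Qed.

End Comparison.

(** * Ext along a universal arrow *)

Section ExtUniversal.
Local Open Scope ring_scope.

Section Augmented.
Variables (C : abcat) (X : C) (I : injective_resolution X).

Definition augmented_term (k : nat) : C :=
  if k is k'.+1 then res_ob I k' else X.

Definition augmented_diff (k : nat) :
    Mor (augmented_term k) (augmented_term k.+1) :=
  match k with 0 => res_aug I | k'.+1 => res_d I k' end.

Lemma augmented_exact k : exact (augmented_diff k) (augmented_diff k.+1).
Proof. by case: k => [|k]; [exact: res_exact0 | exact: res_exactS]. Qed.

Definition augmented : cochain C :=
  @Cochain C augmented_term augmented_diff
    (fun k => exact_comp0 (augmented_exact k)).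

Lemma augmented_resolves n : resolves_upto n augmented.
Proof.
split=> [|k _|k]; first exact: res_aug_monic.
  exact: augmented_exact.
exact: res_inj.
Qed.

End Augmented.

Variables (C D : abcat) (R : functor C D).

Lemma fmap_cdiff2 (X : cochain C) k :
  fmap R (cdiff X k.+1) \oc fmap R (cdiff X k) = 0.
Proof. by rewrite -fmap_comp cdiff2 fmap0. Qed.

Definition map_cochain (X : cochain C) : cochain D :=
  @Cochain D (fun k => R (X k)) (fun k => fmap R (cdiff X k)) (fmap_cdiff2 X).

Variables (M : D) (L : C) (eta : Mor M (R L)).

(** The pair of [L] and [eta] represents Hom(M, R -): the part of the adjunction
that concerns the single object [M]. *)
Definition universal_arrow : Prop :=
  forall (Y : C) (f : Mor M (R Y)), exists! a : Mor L Y, fmap R a \oc eta = f.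

Hypothesis eta_univ : universal_arrow.

Definition transpose (Y : C) (a : Mor L Y) : Mor M (R Y) := fmap R a \oc eta.

Fact transpose_is_zmod_morphism Y : zmod_morphism (@transpose Y).
Proof. by move=> a b; rewrite /transpose fmapB compBm. Qed.

HB.instance Definition _ Y :=
  GRing.isZmodMorphism.Build (Mor L Y) (Mor M (R Y)) (@transpose Y)
    (@transpose_is_zmod_morphism Y).

Lemma transpose_inj Y : injective (@transpose Y).
Proof.
move=> a b ab; have [c [_ cP]] := eta_univ (transpose a).
by rewrite -(cP a erefl) (cP b (esym ab)).
Qed.

Lemma transpose_surj Y (f : Mor M (R Y)) : exists a, transpose a = f.
Proof. by have [a [aP _]] := eta_univ f; exists a. Qed.

Lemma transpose_comp Y Z (d : Mor Y Z) (a : Mor L Y) :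
  transpose (d \oc a) = fmap R d \oc transpose a.
Proof. by rewrite /transpose fmap_comp compA. Qed.

Lemma transpose_cohomology_iso (X : cochain C) k :
  group_iso (cochain_cohomology L X k) (cochain_cohomology M (map_cochain X) k).
Proof.
apply: (@group_homology_iso _ _ _ _ _ _ _ _ _ _ (@transpose (X k.+1))).
- move=> a /= da; rewrite /postcomp -transpose_comp.
  by rewrite [cdiff X _ \oc a]da raddf0.
- by move=> a; exists (transpose a); rewrite /= /postcomp transpose_comp.
- move=> a _ [f]; have [b <-] := transpose_surj f.
  rewrite /= /postcomp -transpose_comp => /transpose_inj <-.
  by exists b.
- move=> f; have [a <-] := transpose_surj f.
  rewrite /= /postcomp -transpose_comp => da.
  exists a; first by apply: transpose_inj; rewrite raddf0.
  by exists 0; rewrite compm0 subrr.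
Qed.

(** In this bound [n] is the degree: by the shift of indices in augmented
complexes, exactness up to degree [n] is exactness up to index [n.+1]. *)
Lemma ext_universal_iso (hC : enough_injectives C) (hD : enough_injectives D)
    (X : C) (n : nat) :
  resolves_upto n.+1 (map_cochain (augmented (inj_res hC X))) ->
  forall j, (1 <= j <= n)%N -> group_iso (Ext hD j M (R X)) (Ext hC j L X).
Proof.
move=> RIr [//|j] /= jn; apply: group_iso_sym.
apply: (group_iso_trans
  (transpose_cohomology_iso (augmented (inj_res hC X)) j.+1)).
have idK : idm (R X) \oc idm (R X) = idm (R X) := comp1m _.
have cmp := @comparison_iso D n.+1 (map_cochain (augmented (inj_res hC X)))
  (augmented (inj_res hD (R X))) M (idm (R X)) (idm (R X)) RIr
  (augmented_resolves _ _) idK idK.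
exact: cmp j.+1 jn.
Qed.

End ExtUniversal.

(** * Criteria for exactness *)

Section Exactness.
Local Open Scope ring_scope.

Lemma to_zero_unique (C : preadd) (Z T : C) (f g : Mor T Z) :
  is_zero Z -> f = g.
Proof. by move=> [_ Z0]; rewrite (Z0 _ f) (Z0 _ g). Qed.

Lemma zero_exact (C : abcat) (X Y Z : C) (f : Mor X Y) (g : Mor Y Z) :
  is_zero Y -> exact f g.
Proof.
move=> [Y0 Y1]; apply: monic_is_kernel; first exact: kernel_monic (kernelP _).
  by rewrite (Y0 _ g) comp0m.
by move=> T t _; exists 0; rewrite compm0 (Y1 _ t).
Qed.

(** Zero homology says that the map induced by f into the kernel of g is epic, so
f and that kernel have the same cokernel, and hence the same image. *)
Lemma zero_homology_exact (C : abcat) (X Y Z : C) (f : Mor X Y) (g : Mor Y Z)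
    (gf0 : g \oc f = 0) :
  is_zero (homology gf0) -> exact f g.
Proof.
move=> [_ h0].
have l_epi : epimorphism (ker_lift gf0) by apply: epic_of_coker0; exact: h0.
have kl : kmap (ker g) \oc ker_lift gf0 = f .
  exact: svalP (cid (ker_lift_ex (kernelP (ker g)) gf0)).
have [i0 _] := kernelP (im f).
have [cf0 _] := cokernelP (coker f).
apply: monic_is_kernel; first exact: kernel_monic (kernelP (im f)).
  have [h <-] := coker_lift_ex (cokernelP (coker f)) gf0.
  by rewrite -compA i0 compm0.
move=> T t /(ker_lift_ex (kernelP (ker g))) [u <-].
apply: (ker_lift_ex (kernelP (im f))); rewrite compA.
suff -> : cmap (coker f) \oc kmap (ker g) = 0 by rewrite comp0m.
by apply: l_epi; rewrite -compA kl cf0 comp0m.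
Qed.

Variables (A B : abcat) (G : functor A B) (hG : left_exact G).
Local Notation D := (comma hG).

(** Kernels and cokernels in the comma category are formed componentwise, so the
components of an image are the images of the components. *)
Lemma comma_exact (M N P : D) (f : Mor M N) (g : Mor N P) :
  exact (cm1 f) (cm1 g) -> exact (cm2 f) (cm2 g) -> exact f g.
Proof. by move=> e1 e2; apply: comma_is_kernel. Qed.

Lemma comma_monomorphism (M N : D) (f : Mor M N) :
  monomorphism (cm1 f) -> monomorphism (cm2 f) -> monomorphism f.
Proof.
move=> m1 m2 T u v fuv; apply: comma_hom_eq.
  by apply: m1; exact: (congr1 (@cm1 _ _ _ _ _) fuv).
by apply: m2; exact: (congr1 (@cm2 _ _ _ _ _) fuv).
Qed.

End Exactness.

(** * The two right adjoints into the comma category *)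

Section CommaAdjoints.
Local Open Scope ring_scope.

Variables (A B : abcat) (G : functor A B) (hG : left_exact G).
Local Notation D := (comma hG).

Definition zero_left_map (Y Z : B) (b : Mor Y Z) :
    @Mor D (comma_zero_left hG Y) (comma_zero_left hG Z).
Proof.
apply: (@mk_comma A B G (comma_zero_left hG Y) (comma_zero_left hG Z) 0 b).
by rewrite /= comp0m fmap0 comp0m.
Defined.

Definition zero_left_functor : functor B D.
Proof.
apply: (@Functor B D (comma_zero_left hG) zero_left_map).
- by move=> X; apply: comma_hom_eq => //=; exact: to_zero_unique zero_obP.
- by move=> X Y Z g f; apply: comma_hom_eq => //=;
  exact: to_zero_unique zero_obP.
- by move=> X Y f g; apply: comma_hom_eq => //=; exact: to_zero_unique zero_obP.
Defined.

Definition unit_map (X Y : A) (a : Mor X Y) :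
    @Mor D (comma_unit hG X) (comma_unit hG Y).
Proof.
apply: (@mk_comma A B G (comma_unit hG X) (comma_unit hG Y) a (fmap G a)).
by rewrite /= comp1m compm1.
Defined.

Definition unit_functor : functor A D.
Proof.
apply: (@Functor A D (comma_unit hG) unit_map).
- by move=> X; apply: comma_hom_eq => //; exact: fmap_id.
- by move=> X Y Z g f; apply: comma_hom_eq => //; exact: fmap_comp.
- by move=> X Y f g; apply: comma_hom_eq => //; exact: fmapD.
Defined.

Definition to_zero_left (M : D) : Mor M (zero_left_functor (co2 M)).
Proof.
apply: (@mk_comma A B G M (comma_zero_left hG (co2 M)) 0 (idm _)).
by rewrite /= comp0m fmap0 comp0m.
Defined.

Lemma to_zero_left_universal M : universal_arrow (to_zero_left M).
Proof.
move=> Y f; exists (cm2 f); split=> [|b <-]; last exact: compm1.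
by apply: comma_hom_eq; [exact: to_zero_unique zero_obP | exact: compm1].
Qed.

Definition to_unit (M : D) : Mor M (unit_functor (co1 M)).
Proof.
apply: (@mk_comma A B G M (comma_unit hG (co1 M)) (idm _) (co_map M)).
by rewrite /= fmap_id.
Defined.

Lemma to_unit_universal M : universal_arrow (to_unit M).
Proof.
move=> X f; exists (cm1 f); split=> [|a <-]; last exact: compm1.
apply: comma_hom_eq; first exact: compm1.
by rewrite -[RHS]comp1m; exact: (esym (comma_sq f)).
Qed.

Lemma zero_left_resolves (Y : B) (I : injective_resolution Y) n :
  resolves_upto n (map_cochain zero_left_functor (augmented I)).
Proof.
split=> [|k _|k].
- apply: comma_monomorphism; last exact: res_aug_monic.
  by move=> T u v _; exact: to_zero_unique zero_obP.
- apply: comma_exact; last exact: augmented_exact.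
  exact/zero_exact/zero_obP.
- exact/comma_zero_left_injective/res_inj.
Qed.

(** Exactness at X in degree 0 is left exactness of [G]; above it, the homology
objects are the derived functors. *)
Lemma fmap_augmented_exact (hA : enough_injectives A) (X : A) n :
  (forall j, (1 <= j <= n)%N -> is_zero (right_derived G hA j X)) ->
  forall k, (k < n.+1)%N ->
  exact (fmap G (augmented_diff (inj_res hA X) k))
    (fmap G (augmented_diff (inj_res hA X) k.+1)).
Proof.
move=> RG0 [_|k kn].
  by have [] := hG (@res_aug_monic _ _ (inj_res hA X)) (res_exact0 _).
exact: (zero_homology_exact (RG0 k.+1 kn)).
Qed.

Lemma unit_resolves (hA : enough_injectives A) (X : A) n :
  (forall j, (1 <= j <= n)%N -> is_zero (right_derived G hA j X)) ->
  resolves_upto n.+1 (map_cochain unit_functor (augmented (inj_res hA X))).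
Proof.
move=> RG0; split=> [|k kn|k].
- apply: comma_monomorphism; first exact: res_aug_monic.
  exact/(fmap_monic hG)/res_aug_monic.
- apply: comma_exact; first exact: augmented_exact.
  exact: fmap_augmented_exact RG0 k kn.
- exact/comma_unit_injective/res_inj.
Qed.

End CommaAdjoints.

Theorem lemma3p6 (A B : abcat)
  (pA : enough_projectives A) (hA : enough_injectives A)
  (pB : enough_projectives B) (hB : enough_injectives B)
  (G : functor A B) (hG : left_exact G) (n : nat) (hn : (1 <= n)%N) :
  (forall (M1 : A) (M2 : B) (phi : Mor M2 (G M1)) (Y : B),
     group_iso
       (Ext (comma_enough_injectives hG hA hB) n
          (triple hG phi) (comma_zero_left hG Y))
       (Ext hB n M2 Y)) /\
  (forall (X : A) (Y1 : A) (Y2 : B) (psi : Mor Y2 (G Y1)),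
     (forall j : nat, (1 <= j <= n)%N -> is_zero (right_derived G hA j X)) ->
     forall j : nat, (1 <= j <= n)%N ->
       group_iso
         (Ext (comma_enough_injectives hG hA hB) j
            (triple hG psi) (comma_unit hG X))
         (Ext hA j Y1 X)).
Proof.
split=> [M1 M2 phi Y | X Y1 Y2 psi RG0 j jn].
  have iso := ext_universal_iso (to_zero_left_universal (M := triple hG phi))
    (comma_enough_injectives hG hA hB)
    (zero_left_resolves hG (inj_res hB Y) n.+1).
  by apply: iso; rewrite hn leqnn.
have iso := ext_universal_iso (to_unit_universal (M := triple hG psi))
  (comma_enough_injectives hG hA hB) (unit_resolves hG RG0).
exact: iso j jn.
Qed.
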